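(* Let $\varepsilon>0$, $\eta>0$, $A\ge1$. Consider the fully discrete finite difference scheme on $\mathcal C_{\rm per}$ with time step $s>0$: given $\phi^k\in\mathcal C_{\rm per}$, find $\phi^{k+1},\tilde\mu^{k+1}\in\mathcal C_{\rm per}$ such that $$\phi^{k+1}-s\,\Delta_h\tilde\mu^{k+1}=\phi^k,$$ $$\tilde\mu^{k+1}=3\varepsilon^{-2}(\phi^{k+1})^5+4A(\phi^{k+1})^3+(\varepsilon^{-2}+\eta)\phi^{k+1}+6\phi^{k+1}\,\mathfrak A(|\nabla_h^v\phi^{k+1}|^2)+\varepsilon^2\Delta_h^2\phi^{k+1}$$ $$\qquad-6\nabla_h^v\cdot\big(\mathfrak a((\phi^{k+1})^2)\nabla_h^v\phi^{k+1}\big)-4A\nabla_h^v\cdot\big(|\nabla_h^v\phi^{k+1}|^2\nabla_h^v\phi^{k+1}\big)$$ $$\qquad-(4\varepsilon^{-2}+\eta)(\phi^k)^3+(2+\eta\varepsilon^2)\Delta_h^v\phi^k-4A(\phi^k)^3+4A\nabla_h^v\cdot\big(|\nabla_h^v\phi^k|^2\nabla_h^v\phi^k\big).$$ Then the scheme is unconditionally uniquely solvable and unconditionally discrete energy stable: for every $h=L/m$, every $s>0$ and every $\phi^k\in\mathcal C_{\rm per}$ there is a unique solution, and it satisfies $\mathcal F_h(\phi^{k+1})\le\mathcal F_h(\phi^k)$.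
   Context: Let $\Omega=(0,L)^2$, $L>0$, $m$ a positive integer, $h=L/m$. $\mathcal C_{\rm per}$ is the space of cell-centered grid functions $\nu=(\nu_{i,j})_{i,j\in\mathbb Z}$, real-valued and $m$-periodic in $i$ and in $j$; $\mathcal V_{\rm per}$ is the space of vertex-centered grid functions $(\nu_{i+\frac12,j+\frac12})_{i,j\in\mathbb Z}$, $m$-periodic in both indices. Products and powers of grid functions are pointwise. Operators $\mathcal C_{\rm per}\to\mathcal V_{\rm per}$: $\mathfrak D_x\nu_{i+\frac12,j+\frac12}=\frac1{2h}(\nu_{i+1,j+1}-\nu_{i,j+1}+\nu_{i+1,j}-\nu_{i,j})$, $\mathfrak D_y\nu_{i+\frac12,j+\frac12}=\frac1{2h}(\nu_{i+1,j+1}-\nu_{i+1,j}+\nu_{i,j+1}-\nu_{i,j})$, $\mathfrak a\nu_{i+\frac12,j+\frac12}=\frac14(\nu_{i,j}+\nu_{i+1,j}+\nu_{i,j+1}+\nu_{i+1,j+1})$; $\nabla_h^v\nu=(\mathfrak D_x\nu,\mathfrak D_y\nu)$ and $|\nabla_h^v\nu|^2=(\mathfrak D_x\nu)^2+(\mathfrak D_y\nu)^2$. Operators $\mathcal V_{\rm per}\to\mathcal C_{\rm per}$: $\mathfrak d_x\nu_{i,j}=\frac1{2h}(\nu_{i+\frac12,j+\frac12}-\nu_{i-\frac12,j+\frac12}+\nu_{i+\frac12,j-\frac12}-\nu_{i-\frac12,j-\frac12})$, $\mathfrak d_y\nu_{i,j}=\frac1{2h}(\nu_{i+\frac12,j+\frac12}-\nu_{i+\frac12,j-\frac12}+\nu_{i-\frac12,j+\frac12}-\nu_{i-\frac12,j-\frac12})$,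 $\mathfrak A\nu_{i,j}=\frac14(\nu_{i-\frac12,j-\frac12}+\nu_{i-\frac12,j+\frac12}+\nu_{i+\frac12,j+\frac12}+\nu_{i+\frac12,j-\frac12})$. For $r\in\mathcal V_{\rm per}$, $\nabla_h^v\cdot(r\nabla_h^v\nu)=\mathfrak d_x(r\,\mathfrak D_x\nu)+\mathfrak d_y(r\,\mathfrak D_y\nu)$; $\Delta_h^v\nu=\nabla_h^v\cdot(\nabla_h^v\nu)$. The standard Laplacian on $\mathcal C_{\rm per}$ is $\Delta_h\nu_{i,j}=h^{-2}(\nu_{i+1,j}+\nu_{i-1,j}+\nu_{i,j+1}+\nu_{i,j-1}-4\nu_{i,j})$, and $\Delta_h^2=\Delta_h\Delta_h$. Inner products and norms: $(\nu,\xi)_2=h^2\sum_{i,j=1}^m\nu_{i,j}\xi_{i,j}$ on $\mathcal C_{\rm per}$; $\langle\nu,\xi\rangle=(\mathfrak A(\nu\xi),1)_2$ on $\mathcal V_{\rm per}$; $\|\nu\|_p^p=(|\nu|^p,1)_2$; $\|\nabla_h^v\nu\|_p^p=\langle|\nabla_h^v\nu|^p,1\rangle$. Discrete energy: $\mathcal F_h=\mathcal F_{c,h}-\mathcal F_{e,h}$ with $$\mathcal F_{c,h}(\phi)=\tfrac{\varepsilon^{-2}}2\|\phi\|_6^6+\big(\tfrac{\varepsilon^{-2}}2+\tfrac\eta2\big)\|\phi\|_2^2+\tfrac{\varepsilon^2}2\|\Delta_h\phi\|_2^2+A\|\phi\|_4^4+A\|\nabla_h^v\phi\|_4^4+3\big(\phi^2,\mathfrak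 A(|\nabla_h^v\phi|^2)\big)_2,$$ $$\mathcal F_{e,h}(\phi)=\big(\varepsilon^{-2}+\tfrac\eta4\big)\|\phi\|_4^4+\big(1+\tfrac{\eta\varepsilon^2}2\big)\|\nabla_h^v\phi\|_2^2+A\|\phi\|_4^4+A\|\nabla_h^v\phi\|_4^4.$$ The formula for $\tilde\mu^{k+1}$ is $\delta_\phi\mathcal F_{c,h}(\phi^{k+1})-\delta_\phi\mathcal F_{e,h}(\phi^k)$, where $\delta_\phi$ is the gradient with respect to $(\cdot,\cdot)_2$. *)

(* Defs.v *)
From mathcomp Require Import all_boot all_order all_algebra.
From mathcomp Require Import reals.

Set Implicit Arguments.
Unset Strict Implicit.
Unset Printing Implicit Defensive.

Import Order.TTheory GRing.Theory Num.Theory.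
Local Open Scope ring_scope.

(* [nu i j] is the value at the cell centre (i, j). *)
Definition cellfun (R : realType) := int -> int -> R.

(* [r i j] is the value at the vertex (i + 1/2, j + 1/2), so the vertex
   (i - 1/2, j - 1/2) is reached at [r (i - 1) (j - 1)]. *)
Definition vertfun (R : realType) := int -> int -> R.

(* Membership in C_per.  The operators below are defined on all grid functions
   and preserve periodicity. *)
Definition Cper (R : realType) (m : nat) (nu : cellfun R) : Prop :=
  forall i j : int, nu (i + m%:Z) j = nu i j /\ nu i (j + m%:Z) = nu i j.

Definition Dx (R : realType) (h : R) (nu : cellfun R) : vertfun R :=
  fun i j =>
    (2 * h)^-1 * (nu (i + 1) (j + 1) - nu i (j + 1) + nu (i + 1) j - nu i j).

Definition Dy (R : realType) (h : R) (nu : cellfun R) : vertfun R :=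
  fun i j =>
    (2 * h)^-1 * (nu (i + 1) (j + 1) - nu (i + 1) j + nu i (j + 1) - nu i j).

Definition avg_cv (R : realType) (nu : cellfun R) : vertfun R :=
  fun i j =>
    4^-1 * (nu i j + nu (i + 1) j + nu i (j + 1) + nu (i + 1) (j + 1)).

Definition dx (R : realType) (h : R) (r : vertfun R) : cellfun R :=
  fun i j =>
    (2 * h)^-1 * (r i j - r (i - 1) j + r i (j - 1) - r (i - 1) (j - 1)).

Definition dy (R : realType) (h : R) (r : vertfun R) : cellfun R :=
  fun i j =>
    (2 * h)^-1 * (r i j - r i (j - 1) + r (i - 1) j - r (i - 1) (j - 1)).

Definition avg_vc (R : realType) (r : vertfun R) : cellfun R :=
  fun i j =>
    4^-1 * (r (i - 1) (j - 1) + r (i - 1) j + r i j + r i (j - 1)).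

Definition gradsq (R : realType) (h : R) (nu : cellfun R) : vertfun R :=
  fun i j => Dx h nu i j ^+ 2 + Dy h nu i j ^+ 2.

Definition divgrad (R : realType) (h : R) (r : vertfun R) (nu : cellfun R) :
    cellfun R :=
  fun i j => dx h (fun a b => r a b * Dx h nu a b) i j
           + dy h (fun a b => r a b * Dy h nu a b) i j.

(* Delta_h^v: it couples (i, j) only with its diagonal neighbours, unlike [lap]. *)
Definition lapv (R : realType) (h : R) (nu : cellfun R) : cellfun R :=
  fun i j => dx h (Dx h nu) i j + dy h (Dy h nu) i j.

Definition lap (R : realType) (h : R) (nu : cellfun R) : cellfun R :=
  fun i j =>
    h ^- 2 * (nu (i + 1) j + nu (i - 1) j + nu i (j + 1) + nu i (j - 1)
              - 4 * nu i j).

Definition ipc (R : realType) (h : R) (m : nat) (nu xi : cellfun R) : R :=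
  h ^+ 2 * \sum_(1 <= i < m.+1) \sum_(1 <= j < m.+1)
             nu i%:Z j%:Z * xi i%:Z j%:Z.

Definition ipv (R : realType) (h : R) (m : nat) (r q : vertfun R) : R :=
  ipc h m (avg_vc (fun i j => r i j * q i j)) (fun _ _ => 1).

(* [normp] and [gradnormp] are p-th powers of p-norms; no root is taken. *)
Definition normp (R : realType) (h : R) (m p : nat) (nu : cellfun R) : R :=
  ipc h m (fun i j => `|nu i j| ^+ p) (fun _ _ => 1).

Definition gradnormp (R : realType) (h : R) (m p : nat) (nu : cellfun R) : R :=
  ipv h m (fun i j => Num.sqrt (gradsq h nu i j) ^+ p) (fun _ _ => 1).

Definition Fc (R : realType) (eps eta A h : R) (m : nat) (phi : cellfun R) : R :=
  eps ^- 2 / 2 * normp h m 6 phi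
  + (eps ^- 2 / 2 + eta / 2) * normp h m 2 phi
  + eps ^+ 2 / 2 * normp h m 2 (lap h phi)
  + A * normp h m 4 phi
  + A * gradnormp h m 4 phi
  + 3 * ipc h m (fun i j => phi i j ^+ 2) (avg_vc (gradsq h phi)).

Definition Fe (R : realType) (eps eta A h : R) (m : nat) (phi : cellfun R) : R :=
  (eps ^- 2 + eta / 4) * normp h m 4 phi
  + (1 + eta * eps ^+ 2 / 2) * gradnormp h m 2 phi
  + A * normp h m 4 phi
  + A * gradnormp h m 4 phi.

Definition energy (R : realType) (eps eta A h : R) (m : nat) (phi : cellfun R) :
    R :=
  Fc eps eta A h m phi - Fe eps eta A h m phi.

(* Right-hand side of the equation for the chemical potential, with [phi] the
   new (implicit) and [phik] the old (explicit) time level. *)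
Definition chem_pot (R : realType) (eps eta A h : R) (phik phi : cellfun R) :
    cellfun R :=
  fun i j =>
    3 * eps ^- 2 * phi i j ^+ 5
    + 4 * A * phi i j ^+ 3
    + (eps ^- 2 + eta) * phi i j
    + 6 * phi i j * avg_vc (gradsq h phi) i j
    + eps ^+ 2 * lap h (lap h phi) i j
    - 6 * divgrad h (avg_cv (fun a b => phi a b ^+ 2)) phi i j
    - 4 * A * divgrad h (gradsq h phi) phi i j
    - (4 * eps ^- 2 + eta) * phik i j ^+ 3
    + (2 + eta * eps ^+ 2) * lapv h phik i j
    - 4 * A * phik i j ^+ 3
    + 4 * A * divgrad h (gradsq h phik) phik i j.

Definition scheme_sol (R : realType) (eps eta A h : R) (m : nat) (s : R)
    (phik phi mu : cellfun R) : Prop :=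
  [/\ Cper m phi,
      Cper m mu,
      (forall i j : int, phi i j - s * lap h mu i j = phik i j) &
      (forall i j : int, mu i j = chem_pot eps eta A h phik phi i j)].

(* Main.v *)
(* Every integrand of F_c and F_e is a sum of even powers of linear forms in the
   nodal values: this is clear except for the coupled quartic
   A x^4 + A |p|^4 + 3 x^2 |p|^2, where it uses A >= 1.  Hence both energies lie
   above their tangents, F_c strongly so.  Energy stability is then convex
   splitting: F(phi^{k+1}) - F(phi^k) <= (mu, phi^{k+1} - phi^k)
   = s (mu, Delta_h mu) <= 0; uniqueness is strong monotonicity of delta F_c.
   For existence, phi = phi^k + s Delta_h mu is substituted and a convex coercive
   functional of mu alone is minimised over R^(m*m), which avoids the discrete
   H^{-1} norm; at a minimiser Delta_h (delta F_c - delta F_e - mu) = 0, so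
   replacing mu by the chemical potential of phi does not change Delta_h mu. *)

Require Import Defs.
From mathcomp Require Import all_boot all_order all_algebra.
From mathcomp Require Import reals.
From mathcomp Require Import boolp classical_sets topology normedtype derive.
From mathcomp Require Import ring lra.

Set Implicit Arguments.
Unset Strict Implicit.
Unset Printing Implicit Defensive.

Import Order.TTheory GRing.Theory Num.Theory.
Import numFieldNormedType.Exports.
Local Open Scope ring_scope.

(** * Sums over the periodic grid *)

Section Periodic.
Variables (R : realType) (m : nat).
Implicit Types (f g r : cellfun R) (h c : R).

Lemma Cper_tr f : Cper m f -> Cper m (fun i j => f j i).
Proof. by move=> per i j; have [? ?] := per j i. Qed.

Lemma Cper_shift a b f : Cper m f -> Cper m (fun i j => f (i + a) (j + b)).
Proof.
by move=> per i j; rewrite !(addrAC _ m%:Z); have [? ?] := per (i + a) (j + b).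
Qed.

Lemma Cper_op2 (op : R -> R -> R) f g :
  Cper m f -> Cper m g -> Cper m (fun i j => op (f i j) (g i j)).
Proof.
by move=> pf pg i j; have [-> ->] := pf i j; have [-> ->] := pg i j.
Qed.

Lemma Cper_op1 (op : R -> R) f : Cper m f -> Cper m (fun i j => op (f i j)).
Proof. by move=> pf i j; have [-> ->] := pf i j. Qed.

Lemma Cper_cst c : Cper m (fun _ _ => c).
Proof. by []. Qed.

Lemma CperD f g : Cper m f -> Cper m g -> Cper m (fun i j => f i j + g i j).
Proof. exact: Cper_op2. Qed.
Lemma CperM f g : Cper m f -> Cper m g -> Cper m (fun i j => f i j * g i j).
Proof. exact: Cper_op2. Qed.
Lemma CperN f : Cper m f -> Cper m (fun i j => - f i j).
Proof. exact: Cper_op1. Qed.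
Lemma CperX n f : Cper m f -> Cper m (fun i j => f i j ^+ n).
Proof. exact: (@Cper_op1 (fun x => x ^+ n)). Qed.

Lemma Cper_shiftx a f : Cper m f -> Cper m (fun i j => f (i + a) j).
Proof. by move=> per i j; rewrite (addrAC _ m%:Z); have [? ?] := per (i + a) j. Qed.
Lemma Cper_shifty a f : Cper m f -> Cper m (fun i j => f i (j + a)).
Proof. by move=> per i j; rewrite (addrAC _ m%:Z); have [? ?] := per i (j + a). Qed.

End Periodic.

(** Recursion on the body of the grid function. The constant pattern comes last: it accepts only
    bodies in which neither index occurs. *)
Ltac per := repeat (cbv beta; first [ assumption | lazymatch goal with
  | |- Cper _ (fun i j => @?f i j + @?g i j) => apply: (@CperD _ _ f g)
  | |- Cper _ (fun i j => - @?f i j) => apply: (@CperN _ _ f)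
  | |- Cper _ (fun i j => @?f i j * @?g i j) => apply: (@CperM _ _ f g)
  | |- Cper _ (fun i j => @?f i j ^+ ?n) => apply: (@CperX _ _ n f)
  | |- Cper _ (fun i j => ?f (i + ?a) (j + ?b)) => apply: (@Cper_shift _ _ a b f)
  | |- Cper _ (fun i j => ?f (i + ?a) j) => apply: (@Cper_shiftx _ _ a f)
  | |- Cper _ (fun i j => ?f i (j + ?b)) => apply: (@Cper_shifty _ _ b f)
  | |- Cper _ (fun i j => ?c) => apply: (@Cper_cst _ _ c)
  end ]).

Section PeriodicOperators.
Variables (R : realType) (m : nat).
Implicit Types (f g r : cellfun R) (h c : R).

Lemma Cper_Dx h f : Cper m f -> Cper m (Dx h f).
Proof. by move=> pf; rewrite /Dx; per. Qed.
Lemma Cper_Dy h f : Cper m f -> Cper m (Dy h f).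
Proof. by move=> pf; rewrite /Dy; per. Qed.
Lemma Cper_avg_cv f : Cper m f -> Cper m (avg_cv f).
Proof. by move=> pf; rewrite /avg_cv; per. Qed.
Lemma Cper_dx h f : Cper m f -> Cper m (dx h f).
Proof. by move=> pf; rewrite /dx; per. Qed.
Lemma Cper_dy h f : Cper m f -> Cper m (dy h f).
Proof. by move=> pf; rewrite /dy; per. Qed.
Lemma Cper_avg_vc f : Cper m f -> Cper m (avg_vc f).
Proof. by move=> pf; rewrite /avg_vc; per. Qed.
Lemma Cper_lap h f : Cper m f -> Cper m (lap h f).
Proof. by move=> pf; rewrite /lap; per. Qed.
Lemma Cper_gradsq h f : Cper m f -> Cper m (gradsq h f).
Proof. by move=> pf; rewrite /gradsq /Dx /Dy; per. Qed.
Lemma Cper_divgrad h r f : Cper m r -> Cper m f -> Cper m (divgrad h r f).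
Proof.
move=> pr pf; rewrite /divgrad; per.
- by apply: (@Cper_dx h (fun i j => r i j * Dx h f i j)); per; exact: Cper_Dx.
- by apply: (@Cper_dy h (fun i j => r i j * Dy h f i j)); per; exact: Cper_Dy.
Qed.

End PeriodicOperators.

(** * Summation over one period and summation by parts *)

Section TorusSums.
Variables (R : realType) (m : nat).
Implicit Types (f g r : cellfun R) (h c : R).

(** The inner product without its weight: identities are proved for this sum, and [ipcE] restores
    the factor [h ^+ 2]. *)
Definition tsum f : R :=
  \sum_(1 <= i < m.+1) \sum_(1 <= j < m.+1) f i%:Z j%:Z.

Lemma eq_tsum f g : (forall i j, f i j = g i j) -> tsum f = tsum g.
Proof. by move=> e; apply: eq_bigr => i _; apply: eq_bigr => j _. Qed.

Lemma ipcE h f g : ipc h m f g = h ^+ 2 * tsum (fun i j => f i j * g i j).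
Proof. by []. Qed.

Lemma tsumD f g : tsum (fun i j => f i j + g i j) = tsum f + tsum g.
Proof.
by rewrite -big_split; apply: eq_bigr => i _ /=; rewrite -big_split.
Qed.

Lemma tsumZ c f : tsum (fun i j => c * f i j) = c * tsum f.
Proof. by rewrite mulr_sumr; apply: eq_bigr => i _; rewrite mulr_sumr. Qed.

Lemma tsumN f : tsum (fun i j => - f i j) = - tsum f.
Proof.
by rewrite -mulN1r -tsumZ; apply: eq_tsum => i j; rewrite mulN1r.
Qed.

Lemma tsumB f g : tsum (fun i j => f i j - g i j) = tsum f - tsum g.
Proof. by rewrite -tsumN -tsumD. Qed.

Lemma tsum_cst c : tsum (fun _ _ => c) = m%:R ^+ 2 * c.
Proof.
rewrite /tsum (eq_bigr (fun _ => m%:R * c)); last first.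
  by move=> i _; rewrite sumr_const_nat subn1 mulr_natl.
by rewrite sumr_const_nat subn1 -[LHS]mulr_natl expr2 mulrA.
Qed.

Lemma ler_tsum f g : (forall i j, f i j <= g i j) -> tsum f <= tsum g.
Proof. by move=> e; apply: ler_sum => i _; apply: ler_sum => j _. Qed.

Lemma tsum_ge0 f : (forall i j, 0 <= f i j) -> 0 <= tsum f.
Proof. by move=> e; apply: sumr_ge0 => i _; apply: sumr_ge0 => j _. Qed.

Lemma tsum_tr f : tsum (fun i j => f j i) = tsum f.
Proof. by rewrite /tsum exchange_big. Qed.

(** The shift trades the term at [1] for the one at [m + 1], and periodicity identifies the two. *)
Lemma sum_shift1 (G : int -> R) : (forall i, G (i + m%:Z) = G i) ->
  \sum_(1 <= i < m.+1) G (i%:Z + 1) = \sum_(1 <= i < m.+1) G i%:Z.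
Proof.
move=> per; case: m per => [|n] per; first by rewrite !big_geq.
rewrite big_nat_recr //= [RHS]big_ltn // addrC [in RHS]big_add1 /=.
congr (_ + _); last by apply: eq_bigr => i _; rewrite -addn1 PoszD.
by rewrite addrC per.
Qed.

Lemma tsum_shiftx f : Cper m f -> tsum (fun i j => f (i + 1) j) = tsum f.
Proof.
move=> per; rewrite /tsum exchange_big [RHS]exchange_big /=.
by apply: eq_bigr => j _; apply: (sum_shift1 (G := f^~ j%:Z)) => i; case: (per i j).
Qed.

Lemma tsum_shifty f : Cper m f -> tsum (fun i j => f i (j + 1)) = tsum f.
Proof.
move=> per; rewrite -tsum_tr -[RHS]tsum_tr.
exact: (tsum_shiftx (Cper_tr per)).
Qed.

Lemma tsum_shiftxM f g : Cper m f -> Cper m g ->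
  tsum (fun i j => f i j * g (i - 1) j) = tsum (fun i j => f (i + 1) j * g i j).
Proof.
move=> pf pg; rewrite -[LHS](@tsum_shiftx); last by per.
by apply: eq_tsum => i j; rewrite addrK.
Qed.

Lemma tsum_shiftyM f g : Cper m f -> Cper m g ->
  tsum (fun i j => f i j * g i (j - 1)) = tsum (fun i j => f i (j + 1) * g i j).
Proof.
move=> pf pg; rewrite -[LHS](@tsum_shifty); last by per.
by apply: eq_tsum => i j; rewrite addrK.
Qed.

Lemma tsum_shiftxyM f g : Cper m f -> Cper m g ->
  tsum (fun i j => f i j * g (i - 1) (j - 1))
  = tsum (fun i j => f (i + 1) (j + 1) * g i j).
Proof.
move=> pf pg.
rewrite (@tsum_shiftyM f (fun i j => g (i - 1) j)) //; last by per.
by rewrite (@tsum_shiftxM (fun i j => f i (j + 1)) g) //; per.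
Qed.

(** Each backward shift of [r] becomes a forward shift of [f] after reindexing the torus, so the two
    averages are adjoint. *)
Lemma tsum_mul_avg_vc f r : Cper m f -> Cper m r ->
  tsum (fun i j => f i j * avg_vc r i j) = tsum (fun i j => avg_cv f i j * r i j).
Proof.
move=> pf pr; rewrite /avg_vc /avg_cv.
transitivity (4^-1 * (tsum (fun i j => f i j * r (i - 1) (j - 1))
  + tsum (fun i j => f i j * r (i - 1) j) + tsum (fun i j => f i j * r i j)
  + tsum (fun i j => f i j * r i (j - 1)))).
  by rewrite -!tsumD -tsumZ; apply: eq_tsum => i j; ring.
rewrite tsum_shiftxyM // tsum_shiftxM // tsum_shiftyM //.
by rewrite -!tsumD -tsumZ; apply: eq_tsum => i j; ring.
Qed.

Lemma tsum_avg_vc r : Cper m r -> tsum (avg_vc r) = tsum r.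
Proof.
move=> pr; transitivity (tsum (fun i j => 1 * avg_vc r i j)).
  by apply: eq_tsum => i j; rewrite mul1r.
rewrite (@tsum_mul_avg_vc (fun _ _ => 1)) //; apply: eq_tsum => i j.
by rewrite /avg_cv; field.
Qed.

Lemma tsum_avg_cv f : Cper m f -> tsum (avg_cv f) = tsum f.
Proof.
move=> pf; transitivity (tsum (fun i j => avg_cv f i j * 1)).
  by apply: eq_tsum => i j; rewrite mulr1.
rewrite -(@tsum_mul_avg_vc f (fun _ _ => 1)) //; apply: eq_tsum => i j.
by rewrite /avg_vc; field.
Qed.

Lemma tsum_mul_dx h f r : Cper m f -> Cper m r ->
  tsum (fun i j => f i j * dx h r i j) = - tsum (fun i j => Dx h f i j * r i j).
Proof.
move=> pf pr; rewrite /dx /Dx; set c := (2 * h)^-1.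
transitivity (c * (tsum (fun i j => f i j * r i j)
  - tsum (fun i j => f i j * r (i - 1) j) + tsum (fun i j => f i j * r i (j - 1))
  - tsum (fun i j => f i j * r (i - 1) (j - 1)))).
  by rewrite -tsumB -tsumD -tsumB -tsumZ; apply: eq_tsum => i j; ring.
rewrite tsum_shiftxyM // tsum_shiftxM // tsum_shiftyM // -tsumB -tsumD -tsumB.
by rewrite -tsumZ -tsumN; apply: eq_tsum => i j; ring.
Qed.

Lemma tsum_mul_dy h f r : Cper m f -> Cper m r ->
  tsum (fun i j => f i j * dy h r i j) = - tsum (fun i j => Dy h f i j * r i j).
Proof.
move=> pf pr; rewrite /dy /Dy; set c := (2 * h)^-1.
transitivity (c * (tsum (fun i j => f i j * r i j)
  - tsum (fun i j => f i j * r i (j - 1)) + tsum (fun i j => f i j * r (i - 1) j)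
  - tsum (fun i j => f i j * r (i - 1) (j - 1)))).
  by rewrite -tsumB -tsumD -tsumB -tsumZ; apply: eq_tsum => i j; ring.
rewrite tsum_shiftxyM // tsum_shiftxM // tsum_shiftyM // -tsumB -tsumD -tsumB.
by rewrite -tsumZ -tsumN; apply: eq_tsum => i j; ring.
Qed.

(** Discrete Green formula: [dx] and [dy] are minus the adjoints of [Dx] and [Dy], so no boundary
    terms appear. *)
Lemma tsum_mul_divgrad h r f g : Cper m r -> Cper m f -> Cper m g ->
  tsum (fun i j => g i j * divgrad h r f i j)
  = - tsum (fun i j => r i j * (Dx h f i j * Dx h g i j + Dy h f i j * Dy h g i j)).
Proof.
move=> pr pf pg; rewrite /divgrad.
transitivity (tsum (fun i j => g i j * dx h (fun a b => r a b * Dx h f a b) i j)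
  + tsum (fun i j => g i j * dy h (fun a b => r a b * Dy h f a b) i j)).
  by rewrite -tsumD; apply: eq_tsum => i j; rewrite mulrDr.
rewrite tsum_mul_dx //; last by per; exact: Cper_Dx.
rewrite tsum_mul_dy //; last by per; exact: Cper_Dy.
by rewrite -opprD -tsumD; congr (- _); apply: eq_tsum => i j; ring.
Qed.

Lemma tsum_mul_lap h f g : Cper m f -> Cper m g ->
  tsum (fun i j => g i j * lap h f i j)
  = - (h ^- 2 * tsum (fun i j => (f (i + 1) j - f i j) * (g (i + 1) j - g i j)
                               + (f i (j + 1) - f i j) * (g i (j + 1) - g i j))).
Proof.
move=> pf pg; rewrite /lap; set c := h ^- 2.
transitivity (c * (tsum (fun i j => g i j * f (i + 1) j)
  + tsum (fun i j => g i j * f (i - 1) j) + tsum (fun i j => g i j * f i (j + 1))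
  + tsum (fun i j => g i j * f i (j - 1)) - 4 * tsum (fun i j => g i j * f i j))).
  by rewrite -!tsumZ -!tsumD -tsumB -tsumZ; apply: eq_tsum => i j; ring.
rewrite tsum_shiftxM // tsum_shiftyM //.
(* Two of the four diagonal copies are shifted by periodicity; they supply the products at the far
   ends of the edges, which complete the products of differences. *)
have -> : 4 * tsum (fun i j => g i j * f i j)
  = 2 * tsum (fun i j => g i j * f i j) + tsum (fun i j => g (i + 1) j * f (i + 1) j)
    + tsum (fun i j => g i (j + 1) * f i (j + 1)).
  rewrite (@tsum_shiftx (fun i j => g i j * f i j)); last by per.
  by rewrite (@tsum_shifty (fun i j => g i j * f i j)); [ring|per].
rewrite -!tsumZ -!tsumD -tsumB -tsumZ -tsumN; apply: eq_tsum => i j; ring.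
Qed.

Lemma tsum_lap_sym h f g : Cper m f -> Cper m g ->
  tsum (fun i j => g i j * lap h f i j) = tsum (fun i j => lap h g i j * f i j).
Proof.
move=> pf pg; rewrite tsum_mul_lap //.
transitivity (tsum (fun i j => f i j * lap h g i j)).
  rewrite tsum_mul_lap //; congr (- (_ * _)); apply: eq_tsum => i j; ring.
by apply: eq_tsum => i j; rewrite mulrC.
Qed.

Lemma lap_le0 h f : Cper m f -> tsum (fun i j => f i j * lap h f i j) <= 0.
Proof.
move=> pf; rewrite tsum_mul_lap // oppr_le0 mulr_ge0 ?invr_ge0 ?sqr_ge0 //.
by apply: tsum_ge0 => i j; rewrite -!expr2 addr_ge0 ?sqr_ge0.
Qed.

Lemma tsum_lap h f : Cper m f -> tsum (lap h f) = 0.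
Proof.
move=> pf; transitivity (tsum (fun i j => 1 * lap h f i j)).
  by apply: eq_tsum => i j; rewrite mul1r.
rewrite (@tsum_mul_lap h f (fun _ _ => 1)) //.
transitivity (- (h ^- 2 * tsum (fun _ _ : int => 0))); last first.
  by rewrite tsum_cst !mulr0 oppr0.
congr (- (_ * _)); apply: eq_tsum => i j; ring.
Qed.

Lemma Cper_mulz f (i j k l : int) : Cper m f ->
  f (i + k * m%:Z) (j + l * m%:Z) = f i j.
Proof.
move=> pf; have Hx a b (n : nat) : f (a + n%:Z * m%:Z) b = f a b.
  elim: n => [|n IH]; first by rewrite mul0r addr0.
  rewrite -[in LHS]addn1 PoszD mulrDl mul1r addrA.
  by have [-> _] := pf (a + n%:Z * m%:Z) b.
have Hy a b (n : nat) : f a (b + n%:Z * m%:Z) = f a b.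
  elim: n => [|n IH]; first by rewrite mul0r addr0.
  rewrite -[in LHS]addn1 PoszD mulrDl mul1r addrA.
  by have [_ ->] := pf a (b + n%:Z * m%:Z).
have Hx' a b : f (a + k * m%:Z) b = f a b.
  case: k => n //; rewrite NegzE mulNr -[in RHS](subrK (n.+1%:Z * m%:Z) a).
  by rewrite Hx.
rewrite Hx'; case: l => n //.
by rewrite NegzE mulNr -[in RHS](subrK (n.+1%:Z * m%:Z) j) Hy.
Qed.

Lemma Cper_modz f (i j : int) : Cper m f -> f (i %% m%:Z)%Z (j %% m%:Z)%Z = f i j.
Proof.
move=> pf; rewrite -[LHS](Cper_mulz _ _ (i %/ m%:Z)%Z (j %/ m%:Z)%Z pf).
by congr (f _ _); rewrite addrC -divz_eq.
Qed.

Lemma tsum_ge f (i j : int) : (0 < m)%N -> Cper m f ->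
  (forall i j, 0 <= f i j) -> f i j <= tsum f.
Proof.
move=> m0 pf f0.
have mz : m%:Z != 0 by rewrite -lt0n.
(* [tsum] runs over [1..m] while remainders lie in [0..m-1]; hence [k - 1] is reduced and [1] is
   added back. *)
have rep (k : int) : exists2 n : nat, (1 <= n < m.+1)%N & n%:Z = ((k - 1) %% m%:Z)%Z + 1.
  have := modz_ge0 (k - 1) mz; have := ltz_pmod (k - 1) (m0 : 0 < m%:Z).
  case: ((k - 1) %% m%:Z)%Z => // n nm _; exists n.+1; last by rewrite -addn1 PoszD.
  by rewrite ltnS.
have [a am ea] := rep i; have [b bm eb] := rep j.
have -> : f i j = f a b.
  rewrite ea eb (Cper_modz (f := fun x y => f (x + 1) (y + 1)) (i - 1) (j - 1)).
    by rewrite !subrK.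
  exact: Cper_shift.
rewrite /tsum (big_rem a) /=; last by rewrite mem_index_iota.
rewrite (big_rem b) /=; last by rewrite mem_index_iota.
rewrite -addrA lerDl addr_ge0 ?sumr_ge0 // => *; exact: sumr_ge0.
Qed.

Lemma tsum_eq0 f : (0 < m)%N -> Cper m f -> (forall i j, 0 <= f i j) ->
  tsum f <= 0 -> forall i j, f i j = 0.
Proof.
move=> m0 pf f0 s0 i j; apply/eqP; rewrite eq_le f0 andbT.
exact: le_trans (tsum_ge i j m0 pf f0) s0.
Qed.

End TorusSums.

(** * Tangent inequalities for the convex energies *)

Ltac nonneg := repeat first [ assumption | exact: sqr_ge0 | exact: ler0n
  | match goal with H : forall _, is_true (0 <= _) |- _ => exact: H end
  | rewrite invr_ge0 | apply: mulr_ge0 | apply: addr_ge0 ].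

Section PointwiseConvexity.
Variable R : realFieldType.
Implicit Types u v x y p q A : R.

(** The tangent remainder has the double root [v = u], and its cofactor is a sum of squares. *)
Lemma pow4_tangent u v : 0 <= v ^+ 4 - u ^+ 4 - 4 * u ^+ 3 * (v - u).
Proof.
have -> : v ^+ 4 - u ^+ 4 - 4 * u ^+ 3 * (v - u)
  = (v - u) ^+ 2 * ((v + u) ^+ 2 + 2 * u ^+ 2) by ring.
by nonneg.
Qed.

Lemma pow6_tangent u v : 0 <= v ^+ 6 - u ^+ 6 - 6 * u ^+ 5 * (v - u).
Proof.
have -> : v ^+ 6 - u ^+ 6 - 6 * u ^+ 5 * (v - u)
  = (v - u) ^+ 2 * ((v ^+ 2 + v * u) ^+ 2 + 2 * u ^+ 2 * (v + u) ^+ 2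
                    + 3 * (u ^+ 2) ^+ 2) by ring.
by nonneg.
Qed.

(** [|p|^4] equals [2/3 (p1^4 + p2^4) + ((p1+p2)^4 + (p1-p2)^4) / 6], a sum of fourth powers of
    linear forms, and each of them lies above its tangent. *)
Lemma normsq2_tangent p1 p2 q1 q2 :
  0 <= (q1 ^+ 2 + q2 ^+ 2) ^+ 2 - (p1 ^+ 2 + p2 ^+ 2) ^+ 2
       - 4 * (p1 ^+ 2 + p2 ^+ 2) * (p1 * (q1 - p1) + p2 * (q2 - p2)).
Proof.
have := pow4_tangent p1 q1; have := pow4_tangent p2 q2.
have := pow4_tangent (p1 + p2) (q1 + q2).
have := pow4_tangent (p1 - p2) (q1 - q2).
lra.
Qed.

(* [x^4 + 3 x^2 |p|^2 + |p|^4] is the sum of fourth powers of linear forms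
   [((x+p1)^4 + (x-p1)^4 + (x+p2)^4 + (x-p2)^4) / 4
    + (p1^4 + p2^4 + (p1+p2)^4 + (p1-p2)^4) / 6]. *)
Lemma coupled_quartic_tangent A x p1 p2 y q1 q2 : 1 <= A ->
  0 <= A * y ^+ 4 + A * (q1 ^+ 2 + q2 ^+ 2) ^+ 2
         + 3 * y ^+ 2 * (q1 ^+ 2 + q2 ^+ 2)
     - (A * x ^+ 4 + A * (p1 ^+ 2 + p2 ^+ 2) ^+ 2
         + 3 * x ^+ 2 * (p1 ^+ 2 + p2 ^+ 2))
     - (4 * A * x ^+ 3 * (y - x)
        + 4 * A * (p1 ^+ 2 + p2 ^+ 2) * (p1 * (q1 - p1) + p2 * (q2 - p2))
        + 6 * (x * (y - x)) * (p1 ^+ 2 + p2 ^+ 2)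
        + 6 * x ^+ 2 * (p1 * (q1 - p1) + p2 * (q2 - p2))).
Proof.
rewrite -subr_ge0 => A1.
(* The surplus [(A - 1) (x^4 + |p|^4)] is treated separately; the decomposition into linear forms
   covers the case [A = 1]. *)
have := mulr_ge0 A1 (pow4_tangent x y).
have := mulr_ge0 A1 (normsq2_tangent p1 p2 q1 q2).
have := pow4_tangent (x + p1) (y + q1); have := pow4_tangent (x - p1) (y - q1).
have := pow4_tangent (x + p2) (y + q2); have := pow4_tangent (x - p2) (y - q2).
have := pow4_tangent p1 q1; have := pow4_tangent p2 q2.
have := pow4_tangent (p1 + p2) (q1 + q2).
have := pow4_tangent (p1 - p2) (q1 - q2).
lra.
Qed.

End PointwiseConvexity.

(** * The two convex energies, their gradients and their tangent inequalities *)

Section Energy.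
Variables (R : realType) (m : nat) (eps eta A h : R).
Implicit Types phi psi xi : cellfun R.

(** The gradient of [Fc] for the [ipc] inner product. It is not obtained by differentiation;
    [Fc_tangent] certifies it as a subgradient. *)
Definition dFc phi : cellfun R := fun i j =>
  3 * eps ^- 2 * phi i j ^+ 5
  + 4 * A * phi i j ^+ 3
  + (eps ^- 2 + eta) * phi i j
  + 6 * phi i j * avg_vc (gradsq h phi) i j
  + eps ^+ 2 * lap h (lap h phi) i j
  - 6 * divgrad h (avg_cv (fun a b => phi a b ^+ 2)) phi i j
  - 4 * A * divgrad h (gradsq h phi) phi i j.

Definition dFe phi : cellfun R := fun i j =>
  (4 * eps ^- 2 + eta) * phi i j ^+ 3
  - (2 + eta * eps ^+ 2) * lapv h phi i j
  + 4 * A * phi i j ^+ 3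
  - 4 * A * divgrad h (gradsq h phi) phi i j.

Lemma chem_potE phik phi i j :
  chem_pot eps eta A h phik phi i j = dFc phi i j - dFe phik i j.
Proof. by rewrite /chem_pot /dFc /dFe; ring. Qed.

Lemma normp_even n phi : ~~ odd n ->
  normp h m n phi = h ^+ 2 * tsum m (fun i j => phi i j ^+ n).
Proof.
move=> en; rewrite /normp ipcE; congr (_ * _); apply: eq_tsum => i j.
by rewrite mulr1 -normrX ger0_norm // exprn_even_ge0.
Qed.

(** An exponent of the form [n.*2] turns the square root in [gradnormp] into a polynomial. *)
Lemma gradnormp_double n phi : Cper m phi ->
  gradnormp h m n.*2 phi = h ^+ 2 * tsum m (fun i j => gradsq h phi i j ^+ n).
Proof.
move=> pp; rewrite -(@tsum_avg_vc _ m (fun i j => gradsq h phi i j ^+ n)); last first.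
  by apply: (CperX n); exact: Cper_gradsq.
rewrite /gradnormp /ipv ipcE; congr (_ * _); apply: eq_tsum => i j; rewrite mulr1.
have E a b : Num.sqrt (gradsq h phi a b) ^+ n.*2 * 1 = gradsq h phi a b ^+ n.
  by rewrite mulr1 -mul2n exprM sqr_sqrtr // addr_ge0 ?sqr_ge0.
by rewrite /avg_vc !E.
Qed.

(** The quartic and coupling terms are moved to the vertices, where the gradient lives, by averaging
    powers of [phi]. This makes the coupled quartic a pointwise expression at the four corners of a
    vertex. *)
Definition Fc_density phi : cellfun R := fun i j =>
  eps ^- 2 / 2 * phi i j ^+ 6
  + (eps ^- 2 / 2 + eta / 2) * phi i j ^+ 2
  + eps ^+ 2 / 2 * lap h phi i j ^+ 2
  + A * avg_cv (fun a b => phi a b ^+ 4) i j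
  + A * gradsq h phi i j ^+ 2
  + 3 * (avg_cv (fun a b => phi a b ^+ 2) i j * gradsq h phi i j).

Lemma Fc_tsum phi : Cper m phi ->
  Fc eps eta A h m phi = h ^+ 2 * tsum m (Fc_density phi).
Proof.
move=> pp; rewrite /Fc !normp_even // (gradnormp_double 2) // ipcE.
rewrite tsum_mul_avg_vc; [|by per|exact: Cper_gradsq].
rewrite -(@tsum_avg_cv _ m (fun i j => phi i j ^+ 4)); last by per.
rewrite !(mulrCA _ (h ^+ 2)) -!(mulrDr (h ^+ 2)); congr (_ * _).
by rewrite -!tsumZ -!tsumD; apply: eq_tsum.
Qed.

Lemma ipc_dFc phi xi : Cper m phi -> Cper m xi ->
  ipc h m (dFc phi) xi = h ^+ 2 * tsum m (fun i j =>
    3 * eps ^- 2 * (phi i j ^+ 5 * xi i j)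
    + (eps ^- 2 + eta) * (phi i j * xi i j)
    + eps ^+ 2 * (lap h phi i j * lap h xi i j)
    + 4 * A * avg_cv (fun a b => phi a b ^+ 3 * xi a b) i j
    + 4 * A * (gradsq h phi i j
        * (Dx h phi i j * Dx h xi i j + Dy h phi i j * Dy h xi i j))
    + 6 * (avg_cv (fun a b => phi a b * xi a b) i j * gradsq h phi i j)
    + 6 * (avg_cv (fun a b => phi a b ^+ 2) i j
        * (Dx h phi i j * Dx h xi i j + Dy h phi i j * Dy h xi i j))).
Proof.
move=> pp px; rewrite ipcE; congr (_ * _).
have pg := Cper_gradsq h pp; have pl := Cper_lap h pp.
have pa : Cper m (avg_cv (fun a b => phi a b ^+ 2)) by apply: Cper_avg_cv; per.
have : tsum m (avg_cv (fun a b => phi a b ^+ 3 * xi a b))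
    = tsum m (fun a b => phi a b ^+ 3 * xi a b) by rewrite tsum_avg_cv //; per.
(* The average becomes a variable, so the linearity rewrites treat it as an atom. *)
move: (avg_cv (fun a b => phi a b ^+ 3 * xi a b)) => a3 a3E.
rewrite !tsumD !tsumZ a3E.
rewrite -(@tsum_mul_avg_vc _ m (fun a b => phi a b * xi a b)) //; last by per.
rewrite (tsum_lap_sym h px pl).
have by_parts r : Cper m r ->
    tsum m (fun i j => r i j
      * (Dx h phi i j * Dx h xi i j + Dy h phi i j * Dy h xi i j))
    = - tsum m (fun i j => xi i j * divgrad h r phi i j).
  by move=> pr; rewrite tsum_mul_divgrad ?opprK.
rewrite !by_parts // !mulrN -!tsumZ -!tsumN -!tsumD.
by apply: eq_tsum => i j; rewrite /dFc; ring.
Qed.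

Lemma Dx_sub phi psi i j :
  Dx h (fun a b => psi a b - phi a b) i j = Dx h psi i j - Dx h phi i j.
Proof. by rewrite /Dx; ring. Qed.

Lemma Dy_sub phi psi i j :
  Dy h (fun a b => psi a b - phi a b) i j = Dy h psi i j - Dy h phi i j.
Proof. by rewrite /Dy; ring. Qed.

Lemma lap_sub phi psi i j :
  lap h (fun a b => psi a b - phi a b) i j = lap h psi i j - lap h phi i j.
Proof. by rewrite /lap; ring. Qed.

(** The modulus [(eps ^- 2 + eta) / 2] comes from the quadratic term, whose tangent remainder is
    exactly that multiple of [(psi - phi)^2]. The other terms only have to contribute nonnegative
    remainders. *)
Lemma Fc_tangent phi psi : 0 < eps -> 0 < eta -> 1 <= A ->
  Cper m phi -> Cper m psi ->
  ((eps ^- 2 + eta) / 2)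
    * ipc h m (fun i j => psi i j - phi i j) (fun i j => psi i j - phi i j)
  + ipc h m (dFc phi) (fun i j => psi i j - phi i j)
  + Fc eps eta A h m phi <= Fc eps eta A h m psi.
Proof.
move=> e0 t0 A1 pp ps.
have pd : Cper m (fun i j => psi i j - phi i j) by per.
rewrite ipc_dFc // !Fc_tsum // ipcE mulrCA -!(mulrDr (h ^+ 2)) ler_wpM2l ?sqr_ge0 //.
rewrite -tsumZ -!tsumD; apply: ler_tsum => i j.
rewrite Dx_sub Dy_sub lap_sub /Fc_density /avg_cv /gradsq -subr_ge0.
set p1 := Dx h phi i j; set p2 := Dy h phi i j.
set q1 := Dx h psi i j; set q2 := Dy h psi i j.
have e2 : 0 <= eps ^- 2 by rewrite invr_ge0 sqr_ge0.
have T6 := mulr_ge0 e2 (pow6_tangent (phi i j) (psi i j)).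
have L2 := mulr_ge0 (sqr_ge0 eps) (sqr_ge0 (lap h psi i j - lap h phi i j)).
(* The four corners share the gradient of their vertex, so the mean of the four inequalities is the
   one for the averaged density. *)
have Q1 := coupled_quartic_tangent (phi i j) p1 p2 (psi i j) q1 q2 A1.
have Q2 := coupled_quartic_tangent (phi (i + 1) j) p1 p2 (psi (i + 1) j) q1 q2 A1.
have Q3 := coupled_quartic_tangent (phi i (j + 1)) p1 p2 (psi i (j + 1)) q1 q2 A1.
have Q4 := coupled_quartic_tangent (phi (i + 1) (j + 1)) p1 p2
  (psi (i + 1) (j + 1)) q1 q2 A1.
move: Q1 Q2 Q3 Q4 L2 T6.
move: (phi i j) (phi _ j) (phi i _) (phi _ _) (psi i j) (psi _ j) (psi i _) (psi _ _).
move: (lap h psi i j) (lap h phi i j) p1 p2 q1 q2 (eps ^- 2) => *.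
lra.
Qed.

Lemma Fe_tsum phi : Cper m phi ->
  Fe eps eta A h m phi = h ^+ 2 * tsum m (fun i j =>
    (eps ^- 2 + eta / 4 + A) * phi i j ^+ 4
    + (1 + eta * eps ^+ 2 / 2) * gradsq h phi i j + A * gradsq h phi i j ^+ 2).
Proof.
move=> pp; rewrite /Fe !normp_even // (gradnormp_double 2) // (gradnormp_double 1) //.
rewrite !(mulrCA _ (h ^+ 2)) -!(mulrDr (h ^+ 2)); congr (_ * _).
by rewrite -!tsumZ -!tsumD; apply: eq_tsum => i j; ring.
Qed.

Lemma ipc_dFe phi xi : Cper m phi -> Cper m xi ->
  ipc h m (dFe phi) xi = h ^+ 2 * tsum m (fun i j =>
    (4 * eps ^- 2 + eta + 4 * A) * (phi i j ^+ 3 * xi i j)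
    + (2 + eta * eps ^+ 2)
      * (Dx h phi i j * Dx h xi i j + Dy h phi i j * Dy h xi i j)
    + 4 * A * (gradsq h phi i j
        * (Dx h phi i j * Dx h xi i j + Dy h phi i j * Dy h xi i j))).
Proof.
move=> pp px; rewrite ipcE; congr (_ * _).
have pg := Cper_gradsq h pp.
have by_parts r : Cper m r ->
    tsum m (fun i j => r i j
      * (Dx h phi i j * Dx h xi i j + Dy h phi i j * Dy h xi i j))
    = - tsum m (fun i j => xi i j * divgrad h r phi i j).
  by move=> pr; rewrite tsum_mul_divgrad ?opprK.
(* [lapv] is [divgrad] with coefficient [1]. *)
have by_parts1 : tsum m (fun i j =>
      Dx h phi i j * Dx h xi i j + Dy h phi i j * Dy h xi i j)
    = - tsum m (fun i j => xi i j * lapv h phi i j).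
  transitivity (tsum m (fun i j => (fun _ _ => 1) i j
      * (Dx h phi i j * Dx h xi i j + Dy h phi i j * Dy h xi i j))).
    by apply: eq_tsum => i j; rewrite mul1r.
  rewrite (by_parts (fun _ _ => 1)) //; congr (- _); apply: eq_tsum => i j.
  by rewrite /divgrad /lapv /dx /dy; ring.
rewrite 2!tsumD 3!tsumZ by_parts1 by_parts // !mulrN.
rewrite -!tsumZ -!tsumN -!tsumD; apply: eq_tsum => i j.
by rewrite /dFe; ring.
Qed.

Lemma Fe_tangent phi psi : 0 < eps -> 0 < eta -> 1 <= A ->
  Cper m phi -> Cper m psi ->
  ipc h m (dFe phi) (fun i j => psi i j - phi i j)
  + Fe eps eta A h m phi <= Fe eps eta A h m psi.
Proof.
move=> e0 t0 A1 pp ps.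
have pd : Cper m (fun i j => psi i j - phi i j) by per.
rewrite ipc_dFe // !Fe_tsum // -!(mulrDr (h ^+ 2)) ler_wpM2l ?sqr_ge0 //.
rewrite -!tsumD; apply: ler_tsum => i j.
rewrite Dx_sub Dy_sub /gradsq -subr_ge0.
set p1 := Dx h phi i j; set p2 := Dy h phi i j.
set q1 := Dx h psi i j; set q2 := Dy h psi i j.
have e2 : 0 <= eps ^- 2 by rewrite invr_ge0 sqr_ge0.
have A0 : 0 <= A by exact: le_trans A1.
have T0 := mulr_ge0 e2 (pow4_tangent (phi i j) (psi i j)).
have T1 := mulr_ge0 (ltW t0) (pow4_tangent (phi i j) (psi i j)).
have T2 := mulr_ge0 A0 (pow4_tangent (phi i j) (psi i j)).
have T3 := mulr_ge0 A0 (normsq2_tangent p1 p2 q1 q2).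
have et : 0 <= eta * eps ^+ 2 by rewrite mulr_ge0 ?sqr_ge0 // ltW.
have S1 := mulr_ge0 et (sqr_ge0 (q1 - p1)).
have S2 := mulr_ge0 et (sqr_ge0 (q2 - p2)).
have S3 := sqr_ge0 (q1 - p1).
have S4 := sqr_ge0 (q2 - p2).
move: T0 T1 T2 T3 S1 S2 S3 S4; clear.
move: (phi i j) (psi i j) p1 p2 q1 q2 (eps ^- 2) => *.
lra.
Qed.

Lemma Fc_ge0 phi : 0 < eps -> 0 < eta -> 1 <= A -> Cper m phi ->
  0 <= Fc eps eta A h m phi.
Proof.
move=> e0 t0 A1 pp; rewrite Fc_tsum // mulr_ge0 ?sqr_ge0 //.
have A0 : 0 <= A by exact: le_trans A1.
apply: tsum_ge0 => i j; rewrite /Fc_density /avg_cv /gradsq.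
have ev n (x : R) : 0 <= x ^+ n.*2 by rewrite -mul2n exprM exprn_ge0 ?sqr_ge0.
have [ev4 ev6] := (ev 2, ev 3).
by nonneg; exact: ltW.
Qed.

End Energy.

(** * The scheme and its dual functional *)

Section InnerProduct.
Variables (R : realType) (m : nat) (h : R).
Implicit Types f g u v : cellfun R.

Lemma eq_ipc f g u v : (forall i j, f i j = g i j) ->
  (forall i j, u i j = v i j) -> ipc h m f u = ipc h m g v.
Proof.
by move=> e1 e2; rewrite !ipcE; congr (_ * _); apply: eq_tsum => i j; rewrite e1 e2.
Qed.

Lemma ipcBl f g u :
  ipc h m (fun i j => f i j - g i j) u = ipc h m f u - ipc h m g u.
Proof.
rewrite !ipcE -mulrBr -tsumB; congr (_ * _).
by apply: eq_tsum => i j; rewrite mulrBl.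
Qed.

Lemma ipcDr f u v :
  ipc h m f (fun i j => u i j + v i j) = ipc h m f u + ipc h m f v.
Proof.
rewrite !ipcE -mulrDr -tsumD; congr (_ * _).
by apply: eq_tsum => i j; rewrite mulrDr.
Qed.

Lemma ipcZr c f u : ipc h m f (fun i j => c * u i j) = c * ipc h m f u.
Proof.
rewrite !ipcE mulrCA -(tsumZ _ c); congr (_ * _).
by apply: eq_tsum => i j; rewrite mulrCA.
Qed.

Lemma ipcC f g : ipc h m f g = ipc h m g f.
Proof. by rewrite !ipcE; congr (_ * _); apply: eq_tsum => i j; rewrite mulrC. Qed.

Lemma ipc_ge0 f : 0 <= ipc h m f f.
Proof.
rewrite ipcE mulr_ge0 ?sqr_ge0 //.
by apply: tsum_ge0 => i j; rewrite -expr2 sqr_ge0.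
Qed.

Lemma ipc_lapC f g : Cper m f -> Cper m g ->
  ipc h m g (lap h f) = ipc h m (lap h g) f.
Proof. by move=> pf pg; rewrite !ipcE tsum_lap_sym. Qed.

Lemma ipc_lap_le0 f : Cper m f -> ipc h m f (lap h f) <= 0.
Proof. by move=> pf; rewrite ipcE mulr_ge0_le0 ?sqr_ge0 ?lap_le0. Qed.

Lemma ipc_eq0 f : (0 < m)%N -> h != 0 -> Cper m f -> ipc h m f f <= 0 ->
  forall i j, f i j = 0.
Proof.
move=> m0 h0 pf; rewrite ipcE pmulr_rle0 ?exprn_even_gt0 // => f0 i j.
apply/eqP; rewrite -sqrf_eq0 expr2; apply/eqP.
apply: (tsum_eq0 (f := fun i j => f i j * f i j) m0) => [||//]; first by per.
by move=> a b; rewrite -expr2 sqr_ge0.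
Qed.

End InnerProduct.

(** * Energy stability, uniqueness, and the convex coercive functional of [mu] *)

Section Scheme.
Variables (R : realType) (eps eta A : R).
Hypotheses (heps : 0 < eps) (heta : 0 < eta) (hA : 1 <= A).
Variables (m : nat) (h s : R).
Hypotheses (hm : (0 < m)%N) (hh : 0 < h) (hs : 0 < s).

Local Notation Fc := (Fc eps eta A h m).
Local Notation Fe := (Fe eps eta A h m).
Local Notation dFc := (dFc eps eta A h).
Local Notation dFe := (dFe eps eta A h).
Local Notation ipc := (ipc h m).

Let ceta_gt0 : 0 < (eps ^- 2 + eta) / 2.
Proof. by rewrite divr_gt0 // addr_gt0 // invr_gt0 exprn_gt0. Qed.

Lemma Fc_ge_tangent phi psi : Cper m phi -> Cper m psi ->
  ipc (dFc phi) (fun i j => psi i j - phi i j) + Fc phi <= Fc psi.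
Proof.
move=> pp ps; apply: le_trans (Fc_tangent h heps heta hA pp ps).
rewrite -addrA lerDr mulr_ge0 ?ipc_ge0 //; exact: ltW.
Qed.

Lemma scheme_energy_le phik phi mu : Cper m phik ->
  scheme_sol eps eta A h m s phik phi mu ->
  energy eps eta A h m phi <= energy eps eta A h m phik.
Proof.
move=> pk [pp pm step mueq].
have inc i j : phi i j - phik i j = s * lap h mu i j by rewrite -step; ring.
(* The tangent of [Fc] is taken at the new level and that of [Fe] at the old one, matching the
   implicit and explicit parts of [mu]. *)
have := Fc_ge_tangent pp pk; have := Fe_tangent h heps heta hA pk pp.
have -> : ipc (dFe phik) (fun i j => phi i j - phik i j)
    = s * ipc (dFe phik) (lap h mu).
  by rewrite -ipcZr; apply: eq_ipc.
have -> : ipc (dFc phi) (fun i j => phik i j - phi i j)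
    = - s * ipc (dFc phi) (lap h mu).
  by rewrite -ipcZr; apply: eq_ipc => // i j; rewrite mulNr -inc opprB.
have : s * ipc mu (lap h mu) <= 0 by rewrite pmulr_rle0 ?ipc_lap_le0.
have -> : ipc mu (lap h mu) = ipc (dFc phi) (lap h mu) - ipc (dFe phik) (lap h mu).
  by rewrite -ipcBl; apply: eq_ipc => // i j; rewrite mueq chem_potE.
rewrite /energy; lra.
Qed.

Lemma scheme_phi_unique phik phi1 mu1 phi2 mu2 :
  scheme_sol eps eta A h m s phik phi1 mu1 ->
  scheme_sol eps eta A h m s phik phi2 mu2 -> forall i j, phi1 i j = phi2 i j.
Proof.
move=> [p1 q1 step1 mu1E] [p2 q2 step2 mu2E].
pose mu : cellfun R := fun i j => mu1 i j - mu2 i j.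
have pmu : Cper m mu by rewrite /mu; per.
have inc i j : phi1 i j - phi2 i j = s * lap h mu i j.
  by rewrite lap_sub mulrBr; have := step1 i j; rewrite -(step2 i j); lra.
(* In the sum of the two inequalities the energies cancel. The explicit parts cancel in [mu1 - mu2],
   which leaves [(eps ^- 2 + eta) * d <= s * ipc mu (lap h mu) <= 0]. *)
have := Fc_tangent h heps heta hA p1 p2; have := Fc_tangent h heps heta hA p2 p1.
have -> : ipc (fun i j => phi2 i j - phi1 i j) (fun i j => phi2 i j - phi1 i j)
    = ipc (fun i j => phi1 i j - phi2 i j) (fun i j => phi1 i j - phi2 i j).
  by rewrite !ipcE; congr (_ * _); apply: eq_tsum => i j; ring.
set d := ipc (fun i j => phi1 i j - phi2 i j) (fun i j => phi1 i j - phi2 i j).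
have -> : ipc (dFc phi2) (fun i j => phi1 i j - phi2 i j)
    = s * ipc (dFc phi2) (lap h mu).
  by rewrite -ipcZr; apply: eq_ipc.
have -> : ipc (dFc phi1) (fun i j => phi2 i j - phi1 i j)
    = - s * ipc (dFc phi1) (lap h mu).
  by rewrite -ipcZr; apply: eq_ipc => // i j; rewrite mulNr -inc opprB.
have : s * ipc mu (lap h mu) <= 0 by rewrite pmulr_rle0 ?ipc_lap_le0.
have -> : ipc mu (lap h mu) = ipc (dFc phi1) (lap h mu) - ipc (dFc phi2) (lap h mu).
  rewrite -ipcBl; apply: eq_ipc => // i j.
  by rewrite /mu mu1E mu2E !chem_potE; ring.
move=> H1 H2 H3; have d0 : (eps ^- 2 + eta) / 2 * d <= 0 by lra.
move: d0; rewrite pmulr_rle0 // => d0 i j; apply/eqP; rewrite -subr_eq0.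
by apply/eqP; apply: (ipc_eq0 hm _ _ d0); [rewrite gt_eqF|per].
Qed.

(* The step [phi = phik + s * lap mu] is built into the variable [mu]; the
   penalty [(tsum mu)^2 / 2] fixes the additive constant that it leaves free. *)
Definition step_of (phik mu : cellfun R) : cellfun R :=
  fun i j => phik i j + s * lap h mu i j.

Definition dual_energy (phik mu : cellfun R) : R :=
  - (s / 2) * ipc mu (lap h mu) + tsum m mu ^+ 2 / 2
  + Fc (step_of phik mu) - s * ipc (dFe phik) (lap h mu).

(** The gradient for [ipc]: the chain rule through [step_of] puts [lap] outside since it is
    self-adjoint, and [h ^- 2] compensates for the penalty using the unweighted sum. *)
Definition dual_grad (phik mu : cellfun R) : cellfun R := fun i j =>
  s * lap h (fun a b => dFc (step_of phik mu) a b - dFe phik a b - mu a b) i j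
  + h ^- 2 * tsum m mu.

Lemma Cper_dFc phi : Cper m phi -> Cper m (dFc phi).
Proof.
move=> pp; have pg := Cper_gradsq h pp; have pl := Cper_lap h (Cper_lap h pp).
have pa : Cper m (avg_cv (fun a b => phi a b ^+ 2)) by apply: Cper_avg_cv; per.
have := Cper_divgrad h pg pp; have := Cper_divgrad h pa pp.
by have := Cper_avg_vc pg => *; rewrite /dFc; per.
Qed.

Lemma Cper_dFe phi : Cper m phi -> Cper m (dFe phi).
Proof.
move=> pp; have pg := Cper_gradsq h pp; have := Cper_divgrad h pg pp => pd.
have pl : Cper m (lapv h phi).
  rewrite /lapv; per; first by apply: Cper_dx; exact: Cper_Dx.
  by apply: Cper_dy; exact: Cper_Dy.
by rewrite /dFe; per.
Qed.

Lemma Cper_step_of phik mu : Cper m phik -> Cper m mu -> Cper m (step_of phik mu).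
Proof. by move=> pk pm; have := Cper_lap h pm => ?; rewrite /step_of; per. Qed.

Lemma Cper_dual_grad phik mu : Cper m phik -> Cper m mu ->
  Cper m (dual_grad phik mu).
Proof.
move=> pk pm; have := Cper_dFe pk; have := Cper_dFc (Cper_step_of pk pm).
move=> p1 p2; rewrite /dual_grad.
have /(Cper_lap h) :
    Cper m (fun a b => dFc (step_of phik mu) a b - dFe phik a b - mu a b).
  by per.
by move=> p3; per.
Qed.

(** [Fc] is convex and composed with the affine map [step_of], the Dirichlet part and the penalty
    are nonnegative quadratic forms, and the last term is linear. *)
Lemma dual_energy_tangent phik mu nu : Cper m phik -> Cper m mu -> Cper m nu ->
  ipc (dual_grad phik mu) (fun i j => nu i j - mu i j) + dual_energy phik mu
  <= dual_energy phik nu.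
Proof.
move=> pk pm pn; have h0 : h != 0 by rewrite gt_eqF.
pose d : cellfun R := fun i j => nu i j - mu i j.
have pd : Cper m d by rewrite /d; per.
have pl := Cper_lap h pd.
have psm := Cper_step_of pk pm; have psn := Cper_step_of pk pn.
have pc := Cper_dFc psm; have pe := Cper_dFe pk.
have := Fc_ge_tangent psm psn.
have -> : ipc (dFc (step_of phik mu))
      (fun i j => step_of phik nu i j - step_of phik mu i j)
    = s * ipc (dFc (step_of phik mu)) (lap h d).
  by rewrite -ipcZr; apply: eq_ipc => // i j; rewrite lap_sub /step_of; ring.
have -> : ipc (dual_grad phik mu) d
    = s * (ipc (dFc (step_of phik mu)) (lap h d) - ipc (dFe phik) (lap h d)
           - ipc mu (lap h d)) + tsum m mu * (tsum m nu - tsum m mu).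
  rewrite -!ipcBl ipc_lapC //; last by per.
  have -> : tsum m mu * (tsum m nu - tsum m mu)
      = h ^+ 2 * tsum m (fun i j => h ^- 2 * tsum m mu * d i j).
    by rewrite tsumZ -tsumB; field.
  rewrite !ipcE (mulrCA s) -(mulrDr (h ^+ 2)) -(tsumZ _ s) -tsumD.
  congr (_ * _); apply: eq_tsum => i j.
  by rewrite /dual_grad; ring.
have nuE : ipc nu (lap h nu)
    = ipc mu (lap h mu) + 2 * ipc mu (lap h d) + ipc d (lap h d).
  have lE i j : lap h nu i j = lap h mu i j + lap h d i j by rewrite lap_sub; ring.
  rewrite (eq_ipc m h (f := nu) (u := lap h nu) (g := nu)
    (v := fun i j => lap h mu i j + lap h d i j)) //.
  rewrite ipcDr ipc_lapC // [ipc (lap h nu) mu]ipcC.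
  rewrite (eq_ipc m h (f := mu) (u := lap h nu) (g := mu)
    (v := fun i j => lap h mu i j + lap h d i j)) //.
  rewrite ipcDr ipcBl; ring.
have lE : ipc (dFe phik) (lap h d)
   = ipc (dFe phik) (lap h nu) - ipc (dFe phik) (lap h mu).
  rewrite !ipcE -mulrBr -tsumB; congr (_ * _); apply: eq_tsum => i j.
  by rewrite lap_sub mulrBr.
have dd : 0 <= - (s / 2) * ipc d (lap h d).
  by rewrite mulNr oppr_ge0 mulr_ge0_le0 ?ipc_lap_le0 // divr_ge0 // ltW.
have := sqr_ge0 (tsum m nu - tsum m mu).
rewrite /dual_energy nuE lE; lra.
Qed.

Lemma dual_critical_solution phik mu : Cper m phik -> Cper m mu ->
  (forall i j, dual_grad phik mu i j = 0) ->
  scheme_sol eps eta A h m s phik (step_of phik mu)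
    (chem_pot eps eta A h phik (step_of phik mu)).
Proof.
move=> pk pm crit; have h0 : h != 0 by rewrite gt_eqF.
have ps := Cper_step_of pk pm; have pc := Cper_dFc ps; have pe := Cper_dFe pk.
set w : cellfun R := fun a b => dFc (step_of phik mu) a b - dFe phik a b - mu a b.
have pw : Cper m w by rewrite /w; per.
(* Summing the gradient over the torus kills the Laplacian and leaves a nonzero multiple of
   [tsum m mu]. *)
have S0 : tsum m mu = 0.
  have : tsum m (dual_grad phik mu) = tsum m (fun _ _ => 0) by exact: eq_tsum.
  rewrite tsumD tsumZ tsum_lap // !tsum_cst mulr0 add0r mulr0 => /eqP.
  by rewrite !mulf_eq0 invr_eq0 !expf_eq0 /= (negbTE h0) pnatr_eq0 gtn_eqF // => /eqP.
have w0 i j : lap h w i j = 0.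
  have := crit i j; rewrite /dual_grad S0 mulr0 addr0 => /eqP.
  by rewrite mulf_eq0 gt_eqF //= => /eqP.
have chemE i j : chem_pot eps eta A h phik (step_of phik mu) i j = mu i j + w i j.
  by rewrite chem_potE /w; ring.
split=> //.
- move=> i j; rewrite !chemE; have [-> ->] := pw i j.
  by have [-> ->] := pm i j.
- move=> i j; have -> : lap h (chem_pot eps eta A h phik (step_of phik mu)) i j
      = lap h mu i j + lap h w i j by rewrite /lap !chemE; ring.
  by rewrite w0 /step_of; ring.
Qed.

(** A discrete Poincare bound: edge differences control the oscillation, and the total sum controls
    the remaining constant. *)
Lemma periodic_bound (b : R) (f : cellfun R) : Cper m f ->
  (forall i j, `|f (i + 1) j - f i j| <= b) ->
  (forall i j, `|f i (j + 1) - f i j| <= b) ->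
  `|tsum m f| <= b ->
  forall i j, `|f i j| <= (2 * m%:R + 1) * b.
Proof.
move=> pf bx by_ bS i j.
have b0 : 0 <= b by apply: le_trans bS; exact: normr_ge0.
have walkx k l (n : nat) : `|f (k + n%:Z) l - f k l| <= n%:R * b.
  elim: n => [|n IH]; first by rewrite addr0 subrr normr0 mul0r.
  rewrite -addn1 PoszD addrA natrD mulrDl mul1r.
  rewrite -(subrKA (f (k + n%:Z) l)) [leRHS]addrC; apply: le_trans (ler_normD _ _) _.
  by rewrite lerD.
have walky k l (n : nat) : `|f k (l + n%:Z) - f k l| <= n%:R * b.
  elim: n => [|n IH]; first by rewrite addr0 subrr normr0 mul0r.
  rewrite -addn1 PoszD addrA natrD mulrDl mul1r.
  rewrite -(subrKA (f k (l + n%:Z))) [leRHS]addrC; apply: le_trans (ler_normD _ _) _.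
  by rewrite lerD.
(* Offsets reduced modulo [m] leave fewer than [m] unit steps in each direction. *)
have osc k l : `|f k l - f i j| <= 2 * m%:R * b.
  pose a := `|((k - i) %% m%:Z)%Z|%N; pose c := `|((l - j) %% m%:Z)%Z|%N.
  have mz : m%:Z != 0 by rewrite -lt0n.
  have aE : a%:Z = ((k - i) %% m%:Z)%Z by rewrite /a gez0_abs ?modz_ge0.
  have cE : c%:Z = ((l - j) %% m%:Z)%Z by rewrite /c gez0_abs ?modz_ge0.
  have am : (a < m)%N by rewrite -ltz_nat aE ltz_pmod.
  have cm : (c < m)%N by rewrite -ltz_nat cE ltz_pmod.
  have -> : f k l = f (i + a%:Z) (j + c%:Z).
    rewrite aE cE -[RHS](Cper_mulz _ _ ((k - i) %/ m%:Z)%Z ((l - j) %/ m%:Z)%Z pf).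
    have E x y : x = y + ((x - y) %% m%:Z)%Z + ((x - y) %/ m%:Z)%Z * m%:Z :> int.
      by rewrite -addrA [_ + _ * _]addrC -divz_eq addrC subrK.
    by rewrite -!E.
  rewrite -(subrKA (f i (j + c%:Z))); apply: le_trans (ler_normD _ _) _.
  rewrite mulr2n mulrDl mulrDl mul1r; apply: lerD.
    by apply: le_trans (walkx _ _ _) _; rewrite ler_wpM2r // ler_nat ltnW.
  by apply: le_trans (walky _ _ _) _; rewrite ler_wpM2r // ler_nat ltnW.
have m1 : 1 <= m%:R ^+ 2 :> R by rewrite exprn_ege1 // ler1n.
(* Summing the oscillation bound compares [m^2 * f i j] with the total sum; as [m^2 >= 1], dividing
   by it leaves at most one further [b]. *)
have up : tsum m f <= m%:R ^+ 2 * (f i j + 2 * m%:R * b).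
  rewrite -tsum_cst; apply: ler_tsum => k l.
  by have := osc k l; rewrite ler_norml; lra.
have low : m%:R ^+ 2 * (f i j - 2 * m%:R * b) <= tsum m f.
  rewrite -tsum_cst; apply: ler_tsum => k l.
  by have := osc k l; rewrite ler_norml; lra.
have mb : b <= m%:R ^+ 2 * b by rewrite ler_peMl.
move: bS; rewrite !ler_norml => /andP[b1 b2].
have m2 : 0 < m%:R ^+ 2 :> R by exact: lt_le_trans m1.
apply/andP; split; rewrite -(ler_pM2l m2); lra.
Qed.

Lemma dual_energy_coercive phik : Cper m phik -> exists2 M : R, 0 <= M &
  forall mu, Cper m mu -> dual_energy phik mu <= dual_energy phik (fun _ _ => 0) ->
    forall i j, `|mu i j| <= M.
Proof.
move=> pk; have pe := Cper_dFe pk.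
have h0 : h != 0 by rewrite gt_eqF.
set g := dFe phik in pe *; set J0 := dual_energy phik _.
(* The Dirichlet form of the edge differences; the weight [h ^+ 2] of [ipc] cancels the [h ^- 2] of
   [lap]. *)
pose gd (u v : cellfun R) : cellfun R := fun i j =>
  (u (i + 1) j - u i j) * (v (i + 1) j - v i j)
  + (u i (j + 1) - u i j) * (v i (j + 1) - v i j).
have ipc_lapE u v : Cper m u -> Cper m v ->
    ipc v (lap h u) = - tsum m (gd u v).
  by move=> pu pv; rewrite ipcE tsum_mul_lap // mulrN mulrA divff ?mul1r ?expf_neq0.
have gd0 u i j : 0 <= gd u u i j by rewrite /gd -!expr2 addr_ge0 ?sqr_ge0.
(* [B] is the sublevel value plus the price of absorbing the linear term. It bounds [s/4] times the
   Dirichlet sum plus half the squared total sum, and [b] dominates the resulting bounds on edge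
   differences and on the total. *)
pose B := J0 + s * tsum m (gd g g).
pose b := 1 + 4 * `|B| / s + 2 * `|B|.
have s0 := ltW hs.
have b0 : 0 <= b by rewrite !addr_ge0 ?mulr_ge0 ?invr_ge0.
exists ((2 * m%:R + 1) * b); first by rewrite mulr_ge0 // addr_ge0 ?mulr_ge0.
move=> mu pm Jle.
have pgd : Cper m (gd mu mu) by rewrite /gd; per.
have Dmu0 : 0 <= tsum m (gd mu mu) by exact: tsum_ge0.
have main : s / 4 * tsum m (gd mu mu) + tsum m mu ^+ 2 / 2 <= `|B|.
  apply: le_trans (ler_norm B); rewrite /B.
  have := Fc_ge0 h heps heta hA (Cper_step_of pk pm).
  move: Jle; rewrite {1}/dual_energy !ipc_lapE //.
  (* AM-GM absorbs the linear term of [dual_energy] into its Dirichlet part. *)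
  have : 0 <= tsum m (gd mu mu) / 4 + tsum m (gd g g) + tsum m (gd mu g).
    rewrite -[_ / 4]mulrC -tsumZ -!tsumD; apply: tsum_ge0 => i j; rewrite /gd.
    set x := mu _ j - _; set y := mu _ _ - _; set x' := g _ j - _; set y' := g _ _ - _.
    have := sqr_ge0 (x / 2 + x'); have := sqr_ge0 (y / 2 + y'); lra.
  move=> /(mulr_ge0 s0); lra.
have Db i j : gd mu mu i j <= 4 * `|B| / s.
  apply: le_trans (tsum_ge i j hm pgd (gd0 mu)) _.
  rewrite ler_pdivlMr //; have := sqr_ge0 (tsum m mu); lra.
(* A crude substitute for [|x| <= sqrt c]; it accounts for the summand [1] in [b]. *)
have sqb (x c : R) : x ^+ 2 <= c -> `|x| <= 1 + c.
  by move=> xc; rewrite ler_norml; apply/andP; split; nra.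
have B0 : 0 <= 4 * `|B| / s by rewrite !mulr_ge0 ?invr_ge0.
have nB0 := normr_ge0 B.
apply: periodic_bound => // [i j|i j|].
- apply: le_trans (sqb _ _ (_ : _ <= 4 * `|B| / s)) _; last by rewrite /b; lra.
  by apply: le_trans (Db i j); rewrite /gd -!expr2 lerDl sqr_ge0.
- apply: le_trans (sqb _ _ (_ : _ <= 4 * `|B| / s)) _; last by rewrite /b; lra.
  by apply: le_trans (Db i j); rewrite /gd -!expr2 lerDr sqr_ge0.
- apply: le_trans (sqb _ _ (_ : _ <= 2 * `|B|)) _; last by rewrite /b; lra.
  have := mulr_ge0 s0 Dmu0; lra.
Qed.

End Scheme.

(** * Existence of a minimiser *)

Section Continuity.
Variables (R : realType) (T : topologicalType).
Implicit Types (f g : T -> R) (F G : T -> cellfun R).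

Lemma cont_cst (c : R) : continuous (fun _ : T => c).
Proof. by move=> t; exact: cvg_cst. Qed.

Lemma contD f g : continuous f -> continuous g ->
  continuous (fun t => f t + g t).
Proof. by move=> cf cg t; apply: cvgD; [exact: cf|exact: cg]. Qed.

Lemma contN f : continuous f -> continuous (fun t => - f t).
Proof. by move=> cf t; apply: cvgN; exact: cf. Qed.

Lemma contM f g : continuous f -> continuous g ->
  continuous (fun t => f t * g t).
Proof. by move=> cf cg t; apply: cvgM; [exact: cf|exact: cg]. Qed.

Lemma contX n f : continuous f -> continuous (fun t => f t ^+ n).
Proof.
move=> cf; elim: n => [|n IH]; first exact: cont_cst.
rewrite (_ : (fun t => _) = (fun t => f t * f t ^+ n)); first exact: contM.
by apply/funext => t; rewrite exprS.
Qed.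

Lemma cont_tsum m F : (forall i j, continuous (fun t => F t i j)) ->
  continuous (fun t => tsum m (F t)).
Proof.
move=> cF; apply: continuous_big => [|i _]; first exact: add_continuous.
by apply: continuous_big => [|j _]; first exact: add_continuous.
Qed.

Lemma cont_ipc m (h : R) F G : (forall i j, continuous (fun t => F t i j)) ->
  (forall i j, continuous (fun t => G t i j)) ->
  continuous (fun t => ipc h m (F t) (G t)).
Proof.
move=> cF cG; apply: contM; first exact: cont_cst.
by apply: (@cont_tsum m (fun t i j => F t i j * G t i j)) => i j; apply: contM.
Qed.

End Continuity.

Ltac cont := repeat (cbv beta; lazymatch goal with
  | |- continuous (fun t => @?f t + @?g t) => apply: (@contD _ _ f g)
  | |- continuous (fun t => - @?f t) => apply: (@contN _ _ f)
  | |- continuous (fun t => @?f t * @?g t) => apply: (@contM _ _ f g)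
  | |- continuous (fun t => @?f t ^+ ?n) => apply: (@contX _ _ n f)
  | |- continuous (fun t => tsum ?m (@?F t)) => apply: (@cont_tsum _ _ m F) => ? ?
  | |- continuous (fun t => ipc ?h ?m (@?F t) (@?G t)) =>
    apply: (@cont_ipc _ _ m h F G) => ? ?
  | |- continuous (fun t => ?c) => apply: (@cont_cst _ _ c)
  | |- continuous _ =>
    match goal with H : forall i j : int, @?P i j |- _ => refine (H _ _) end
  end).

Section ContinuityOperators.
Variables (R : realType) (T : topologicalType) (h : R).
Variable F : T -> cellfun R.
Hypothesis cF : forall i j, continuous (fun t => F t i j).

Lemma cont_lap i j : continuous (fun t => lap h (F t) i j).
Proof. by rewrite /lap; cont. Qed.

Lemma cont_gradsq i j : continuous (fun t => gradsq h (F t) i j).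
Proof. by rewrite /gradsq /Dx /Dy; cont. Qed.

Lemma cont_avg_cv i j : continuous (fun t => avg_cv (F t) i j).
Proof. by rewrite /avg_cv; cont. Qed.

Lemma cont_avg_vc i j : continuous (fun t => avg_vc (F t) i j).
Proof. by rewrite /avg_vc; cont. Qed.

Lemma cont_divgrad (K : T -> vertfun R) i j :
  (forall i j, continuous (fun t => K t i j)) ->
  continuous (fun t => divgrad h (K t) (F t) i j).
Proof. by move=> cK; rewrite /divgrad /dx /dy /Dx /Dy; cont. Qed.

End ContinuityOperators.

Section ContinuityEnergy.
Variables (R : realType) (T : topologicalType) (eps eta A h s : R) (m : nat).
Variables (phik : cellfun R) (F : T -> cellfun R).
Hypothesis cF : forall i j, continuous (fun t => F t i j).

Lemma cont_step_of i j : continuous (fun t => step_of h s phik (F t) i j).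
Proof. by have cl := cont_lap (h := h) cF; rewrite /step_of; cont. Qed.

Lemma cont_dFc i j : continuous (fun t => dFc eps eta A h (F t) i j).
Proof.
have cl := cont_lap (h := h) (cont_lap (h := h) cF).
have cg := cont_gradsq (h := h) cF; have ca := cont_avg_vc cg.
have c2 : forall i j, continuous (fun t => F t i j ^+ 2) by move=> a b; cont.
have cd a b : continuous (fun t =>
    divgrad h (avg_cv (fun a b => F t a b ^+ 2)) (F t) a b).
  exact: (@cont_divgrad _ _ h F cF _ a b (cont_avg_cv c2)).
have cd' a b : continuous (fun t => divgrad h (gradsq h (F t)) (F t) a b).
  exact: (@cont_divgrad _ _ h F cF _ a b cg).
by rewrite /dFc; cont.
Qed.

Lemma cont_Fc : (forall t, Cper m (F t)) ->
  continuous (fun t => Fc eps eta A h m (F t)).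
Proof.
(* In density form the energy is polynomial in the nodal values, free of absolute values and square
   roots. *)
move=> pF; rewrite (_ : (fun t => _)
    = (fun t => h ^+ 2 * tsum m (Fc_density eps eta A h (F t)))); last first.
  by apply/funext => t; rewrite Fc_tsum.
have cl := cont_lap (h := h) cF; have cg := cont_gradsq (h := h) cF.
have c2 : forall i j, continuous (fun t => F t i j ^+ 2) by move=> a b; cont.
have c4 : forall i j, continuous (fun t => F t i j ^+ 4) by move=> a b; cont.
have ca2 := cont_avg_cv c2; have ca4 := cont_avg_cv c4.
by rewrite /Fc_density; cont.
Qed.

End ContinuityEnergy.

(** * Minimisation over one period and vanishing of the gradient *)

Section Existence.
Variables (R : realType) (eps eta A : R).
Hypotheses (heps : 0 < eps) (heta : 0 < eta) (hA : 1 <= A).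
Variables (m : nat) (h s : R).
Hypotheses (hm : (0 < m)%N) (hh : 0 < h) (hs : 0 < s).
Variable phik : cellfun R.
Hypothesis hphik : Cper m phik.

Local Notation J := (dual_energy eps eta A m h s phik).
Local Notation G := (dual_grad eps eta A m h s phik).

Lemma cont_dual_energy (T : topologicalType) (F : T -> cellfun R) :
  (forall i j, continuous (fun t => F t i j)) -> (forall t, Cper m (F t)) ->
  continuous (fun t => J (F t)).
Proof.
move=> cF pF; have cl := cont_lap (h := h) cF.
have := @cont_Fc _ _ eps eta A h m _ (@cont_step_of _ _ h s phik _ cF)
  (fun t => Cper_step_of h s hphik (pF t)).
by move=> cfc; rewrite /dual_energy; cont.
Qed.

Lemma cont_dual_grad (T : topologicalType) (F : T -> cellfun R) :
  (forall i j, continuous (fun t => F t i j)) ->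
  forall i j, continuous (fun t => G (F t) i j).
Proof.
move=> cF i j; rewrite /dual_grad.
have cd := @cont_dFc _ _ eps eta A h _ (@cont_step_of _ _ h s phik _ cF).
have cw : forall i j, continuous (fun t => dFc eps eta A h (step_of h s phik (F t)) i j
  - dFe eps eta A h phik i j - F t i j) by move=> a b; cont.
by have cl := cont_lap (h := h) cw; cont.
Qed.

Fact mod_index_subproof (i : int) : (`|(i %% m%:Z)%Z| < m)%N.
Proof.
have mz : m%:Z != 0 by rewrite -lt0n.
by rewrite -ltz_nat gez0_abs ?modz_ge0 ?ltz_pmod.
Qed.

Definition mod_index (i : int) : 'I_m := Ordinal (mod_index_subproof i).

(** Coordinates on C_per: one period of nodal values, flattened to a row vector so that compactness
    of boxes and the extreme value theorem apply. *)
Definition periodic_ext (v : 'rV[R]_(m * m)) : cellfun R :=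
  fun i j => v ord0 (mxvec_index (mod_index i) (mod_index j)).

Lemma Cper_periodic_ext v : Cper m (periodic_ext v).
Proof.
have E i : mod_index (i + m%:Z) = mod_index i.
  by apply: val_inj; rewrite /= modzDr.
by move=> i j; rewrite /periodic_ext !E.
Qed.

Lemma periodic_ext_mxvec (mu : cellfun R) : Cper m mu ->
  periodic_ext (mxvec (\matrix_(a < m, b < m) mu a%:Z b%:Z)) = mu.
Proof.
move=> pm; apply/funext => i; apply/funext => j.
have mz : m%:Z != 0 by rewrite -lt0n.
by rewrite /periodic_ext mxvecE mxE /= !gez0_abs ?modz_ge0 // Cper_modz.
Qed.

Lemma dual_energy_min : exists2 mu, Cper m mu &
  forall nu, Cper m nu -> J mu <= J nu.
Proof.
have [M M0 coer] := dual_energy_coercive heps heta hA hm hh hs hphik.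
pose K : set 'rV[R]_(m * m) := [set v | forall i, `[- M, M]%classic (v ord0 i)]%classic.
have cK : compact K.
  by apply: (@rV_compact _ _ (fun=> `[- M, M]%classic)) => _; exact: segment_compact.
have K0 : (K !=set0)%classic.
  by exists 0 => i; rewrite mxE /= in_itv /= oppr_le0 M0.
have cJ : continuous (fun v => J (periodic_ext v)).
  apply: cont_dual_energy => [i j|]; last exact: Cper_periodic_ext.
  exact: coord_continuous.
have [v vK vmin] := EVT_min_rV K0 cK (continuous_subspaceT cJ).
exists (periodic_ext v); first exact: Cper_periodic_ext.
have inK nu : Cper m nu -> (forall i j, `|nu i j| <= M) ->
    J (periodic_ext v) <= J nu.
  move=> pn bn; rewrite -[in leRHS](periodic_ext_mxvec pn); apply: vmin.
  apply/mem_set => k; case/mxvec_indexP: k => a b.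
  by rewrite mxvecE mxE /= in_itv /= -ler_norml.
(* If [J nu] is at most [J 0], coercivity places [nu] in the box; otherwise the zero function, which
   is in the box, already beats [nu]. *)
move=> nu pn; case: (leP (J nu) (J (fun _ _ => 0))) => [le0|/ltW]; last first.
  by apply: le_trans; apply: inK => // i j; rewrite normr0.
by apply: inK => //; exact: coer.
Qed.

(* Minty's trick: the tangent inequality at [mu + t xi] makes the gradient there
   nonnegative along [xi], and [t] tends to [0]. *)
Lemma dual_grad_min mu : Cper m mu -> (forall nu, Cper m nu -> J mu <= J nu) ->
  forall i j, G mu i j = 0.
Proof.
move=> pm mumin; have pG := Cper_dual_grad eps eta A h s hphik pm.
(* Moving along minus the gradient, the limit inequality reads [0 <= - ipc h m (G mu) (G mu)]. *)
pose xi : cellfun R := fun i j => - G mu i j.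
pose F (t : R) : cellfun R := fun i j => mu i j + t * xi i j.
have pF t : Cper m (F t) by rewrite /F /xi; per.
have cF i j : continuous (fun t => F t i j).
  apply: contD; first exact: cont_cst.
  by apply: contM; [move=> t; exact: cvg_id|exact: cont_cst].
pose k t := ipc h m (G (F t)) xi.
have kpos t : 0 < t -> 0 <= k t.
  move=> t0; have := dual_energy_tangent heps heta hA hh hs hphik (pF t) pm.
  rewrite (eq_ipc m h (g := G (F t)) (v := fun i j => - t * xi i j)) //; last first.
    by move=> i j; rewrite /F; ring.
  rewrite ipcZr => le1; have := le_trans le1 (mumin _ (pF t)).
  by rewrite gerDr mulNr oppr_le0 pmulr_rge0.
have ck : continuous k.
  have cG := cont_dual_grad cF.
  by rewrite /k; cont.
have k0 : 0 <= k 0.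
  (* The sign of [k] is known only for [t > 0], hence the limit from the right. *)
  apply: (cvgr_to_ge (F := ((0 : R)^'+)%classic) (f := k)).
    exact: cvg_at_right_filter (ck 0).
  by near=> t; apply: kpos.
apply: (ipc_eq0 (h := h) hm _ pG); first by rewrite gt_eqF.
have F0 : F 0 = mu by apply/funext => i; apply/funext => j; rewrite /F mul0r addr0.
move: k0; rewrite /k F0 (eq_ipc m h (g := G mu) (v := fun i j => -1 * G mu i j)) //.
  by rewrite ipcZr mulN1r oppr_ge0.
by move=> i j; rewrite mulN1r.
Unshelve. all: by end_near. Qed.

End Existence.

Theorem theorem4p3 (R : realType) (eps eta A : R)
    (heps : 0 < eps) (heta : 0 < eta) (hA : 1 <= A)
    (L : R) (hL : 0 < L) (m : nat) (hm : (0 < m)%N)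
    (h : R) (hh : h = L / m%:R) (s : R) (hs : 0 < s)
    (phik : cellfun R) (hphik : Cper m phik) :
  (exists! sol : cellfun R * cellfun R,
     scheme_sol eps eta A h m s phik sol.1 sol.2)
  /\ (forall phi mu : cellfun R, scheme_sol eps eta A h m s phik phi mu ->
        energy eps eta A h m phi <= energy eps eta A h m phik).
Proof.
have h0 : 0 < h by rewrite hh divr_gt0 // ltr0n.
split; last by move=> phi mu; exact: scheme_energy_le.
have [mu pm mumin] := dual_energy_min heps heta hA hm h0 hs hphik.
have crit := dual_grad_min heps heta hA hm h0 hs hphik pm mumin.
have sol := dual_critical_solution hm h0 hs hphik pm crit.
exists (step_of h s phik mu, chem_pot eps eta A h phik (step_of h s phik mu)).
split=> // -[phi' mu'] /= sol'.
have phiE : step_of h s phik mu = phi'.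
  apply/funext => i; apply/funext => j.
  exact: (scheme_phi_unique heps heta hA hm h0 hs sol sol').
(* The last clause of [scheme_sol] makes the potential a function of [phi], so uniqueness of [phi]
   suffices. *)
rewrite phiE; congr pair; apply/funext => i; apply/funext => j.
by case: sol' => _ _ _ ->.
Qed.
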